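(* Let $(X,\sigma)$ be a (one-sided or two-sided) shift space whose language $\mathcal L$ admits a decomposition $\mathcal L=\mathcal C^p\mathcal G\mathcal C^s$ satisfying: (I) $\mathcal G$ has (S)-specification; (II) $h(\mathcal C^p\cup\mathcal C^s)<h(\mathcal L)=h_{\mathrm{top}}(X,\sigma)$; (III) for every $M\in\mathbb N$ there exists $\tau$ such that given $v\in\mathcal G(M)$, there exist words $u,w$ with $|u|\le\tau$, $|w|\le\tau$ for which $uvw\in\mathcal G$. Let $\mu$ be a limit measure of orbit averages as constructed in the context. Then for every $M\in\mathbb N$ there exists a constant $K_M>0$ such that for every $n\in\mathbb N$ and $w\in\mathcal G(M)_n$, $$\mu([w])\ge K_Me^{-nh(\mathcal L)}.$$
   Context: $\mathbb N=\{0,1,2,\dots\}$. A shift space is a nonempty closed shift-invariant set $X$ of sequences over $\{1,\dots,p\}$, either one-sided ($x=x_1x_2\dots$) or two-sided ($x=\dots x_{-1}x_0x_1\dots$); $\sigma$ is the left shift. Its language $\mathcal L$ is the set of all finite words appearing in sequences of $X$ (including the empty word, of length $0$). $|w|$ is the length of $w$; juxtaposition is concatenation; for $\mathcal D\subset\mathcal L$, $\mathcal D_n$ is the set of words of length $n$ in $\mathcal D$, and $h(\mathcal D)=\varlimsup_{n\to\infty}\frac1n\log\#\mathcal D_n$. $h_{\mathrm{top}}(X,\sigma)$ is the topological entropy. A decomposition $\mathcal L=\mathcal C^p\mathcal G\mathcal C^s$ consists of collections $\mathcal C^p,\mathcal G,\mathcal C^s\subset\mathcal L$ (which may contain the empty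 word) such that every word of $\mathcal L$ can be written (possibly non-uniquely) as $uvw$ with $u\in\mathcal C^p$, $v\in\mathcal G$, $w\in\mathcal C^s$. For $M\in\mathbb N$, $\mathcal G(M)=\{uvw\in\mathcal L \mid u\in\mathcal C^p, v\in\mathcal G, w\in\mathcal C^s, |u|\le M,|w|\le M\}$, and $\mathcal G(M)_n$ is its set of words of length $n$. (S)-specification for $\mathcal G\subset\mathcal L$: there is $t\in\mathbb N$ such that for all $m\ge1$ and $w^1,\dots,w^m\in\mathcal G$ there exist $v^1,\dots,v^{m-1}\in\mathcal L$ with $|v^i|=t$ for all $i$ such that $w^1v^1w^2v^2\cdots v^{m-1}w^m\in\mathcal L$. Construction of $\mu$. For $w\in\mathcal L_n$, the central cylinder $[w]$ is $\{x\in X \mid x_i=w_i \text{ for all } 1\le i\le n\}$ in the one-sided case, and $\{x\in X \mid x_{k+i-1}=w_i \text{ for all } 1\le i\le n\}$ with $k=-\lfloor n/2\rfloor$ in the two-sided case. For each $n\ge1$ choose a finite set $E_n\subset X$ such that for every $w\in\mathcal L_n$ the central cylinder $[w]$ contains exactly one element of $E_n$. Put $\nu_n=\frac1{\#E_n}\sum_{x\in E_n}\delta_x$ and $\mu_n=\frac1n\sum_{k=0}^{n-1}\nu_n\circ\sigma^{-k}$, and let $\mu$ be a weak* limit (along a subsequence) of the sequence $(\mu_n)$. *)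

(* Defs.v *)
From HB Require Import structures.
From mathcomp Require Import all_boot all_order all_algebra finmap.
From mathcomp Require Import all_classical all_reals all_analysis.

Set Implicit Arguments.
Unset Strict Implicit.
Unset Printing Implicit Defensive.

Import Order.TTheory GRing.Theory Num.Theory.
Import numFieldNormedType.Exports.

Local Open Scope classical_set_scope.
Local Open Scope ring_scope.

Inductive sidedness := OneSided | TwoSided.

(* In the one-sided case position i : nat carries the letter x_{i+1}. *)
Definition position (s : sidedness) : Type :=
  match s with OneSided => nat | TwoSided => int end.

Definition advance (s : sidedness) : position s -> nat -> position s :=
  match s with
  | OneSided => fun i k => (i + k)%N
  | TwoSided => fun i k => i + k%:Z
  end.

(* The alphabet {1, ..., p} is 'I_p.+1 with p shifted by one: a nonempty shift
   space forces the alphabet to be nonempty, and measurable types are pointed. *)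
Definition word (p : nat) := seq 'I_p.+1.

Definition fullshift (s : sidedness) (p : nat) : Type :=
  prod_topology (fun _ : position s => discrete_topology 'I_p.+1).

HB.instance Definition _ s p := Topological.on (fullshift s p).
HB.instance Definition _ s p :=
  isPointed.Build (fullshift s p) (fun _ => ord0).

Section shift_spaces.
Variables (s : sidedness) (p : nat).
Local Notation T := (fullshift s p).

Definition left_shift (x : T) : T := fun i => x (advance i 1).

Definition subword (x : T) (i : position s) (n : nat) : word p :=
  mkseq (fun j => x (advance i j)) n.

(* The shift is a homeomorphism in the two-sided case only; for the
   noninvertible one-sided shift, invariance is forward invariance. *)
Definition shift_invariant (X : set T) :=
  match s with
  | OneSided => left_shift @` X `<=` X
  | TwoSided => left_shift @` X = X
  end.

Definition shift_space (X : set T) :=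
  [/\ X !=set0, closed X & shift_invariant X].

Definition language (X : set T) : set (word p) :=
  [set w | exists2 x, X x & exists i, subword x i (size w) = w].

End shift_spaces.

Definition cylinder_start (s : sidedness) (n : nat) : position s :=
  match s with
  | OneSided => 0%N
  | TwoSided => - (n./2)%:Z
  end.

Definition central_cylinder s p (X : set (fullshift s p)) (w : word p) :=
  [set x | X x /\ subword x (cylinder_start s (size w)) (size w) = w].

Section words.
Variables (p : nat).
Implicit Types (L D Cp G Cs : set (word p)).

Definition nb_words D (n : nat) : nat :=
  #|[pred w : n.-tuple 'I_p.+1 | `[< D (tval w) >]]|.

(* lne 0 = -oo, so the entropy of a finite collection is -oo. *)
Definition word_entropy (R : realType) D : \bar R :=
  limn_esup (fun n => ((n%:R)^-1)%:E * lne ((nb_words D n)%:R)%:E)%E.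

Definition decomposition L Cp G Cs :=
  [/\ Cp `<=` L, G `<=` L, Cs `<=` L &
      forall x, L x -> exists u v w, [/\ Cp u, G v, Cs w & x = u ++ v ++ w]].

Definition enlarge L Cp G Cs (M : nat) : set (word p) :=
  [set x | L x /\ exists u v w,
     [/\ x = u ++ v ++ w, Cp u, G v, Cs w & (size u <= M)%N /\ (size w <= M)%N]].

(* The m >= 1 words of the definition are w 0, ..., w m here. *)
Definition specification L G :=
  exists t : nat, forall (m : nat) (w : 'I_m.+1 -> word p),
    (forall i, G (w i)) ->
    exists v : 'I_m -> word p,
      (forall i, L (v i) /\ size (v i) = t) /\
      L (w ord0 ++ \big[cat/[::]]_(i < m) (v i ++ w (lift ord0 i))).

Definition extendable L Cp G Cs :=
  forall M : nat, exists tau : nat, forall v, enlarge L Cp G Cs M v ->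
    exists u w : word p,
      [/\ (size u <= tau)%N, (size w <= tau)%N & G (u ++ v ++ w)].

End words.

(* Topological entropy of f on the f-invariant set X, by open covers
   (Adler, Konheim and McAndrew); open subsets of X are traces of open sets. *)
Section topological_entropy.
Variables (R : realType) (T : topologicalType) (f : T -> T) (X : set T).
Implicit Types U F : set (set T).

Definition open_cover U :=
  (forall V, U V -> open V) /\ X `<=` \bigcup_(V in U) V.

Definition cover_number U : \bar R :=
  ereal_inf [set (n%:R)%:E | n in [set n : nat |
    exists F, [/\ F `<=` U, (F #= `I_n)%card & X `<=` \bigcup_(V in F) V]]].

Definition iterated_cover U (n : nat) : set (set T) :=
  [set \bigcap_(k in `I_n) (iter k f @^-1` V k) | V in
    [set V : nat -> set T | forall k, U (V k)]].

Definition topological_entropy : \bar R :=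
  ereal_sup [set limn_esup (fun n =>
    ((n%:R)^-1)%:E * lne (cover_number (iterated_cover U n)))%E
    | U in open_cover].

End topological_entropy.

Lemma continuous_to_prod (Y : topologicalType) (I : Type)
    (K : I -> topologicalType) (f : Y -> prod_topology K) :
  (forall i, continuous (fun y => f y i)) -> continuous f.
Proof.
move=> cf y; apply/cvg_sup => i U [V [[W oW <-] Wf] /filterS]; apply.
exact: (cf i y _ (open_nbhs_nbhs (conj oW Wf))).
Qed.

Lemma continuous_projection s p (i : position s) :
  continuous (fun x : fullshift s p => x i : discrete_topology 'I_p.+1).
Proof.
by case: s i => i;
  [exact: (@proj_continuous nat) | exact: (@proj_continuous int)].
Qed.

Lemma continuous_shift s p : continuous (@left_shift s p).
Proof.
apply: (@continuous_to_prod (fullshift s p)) => i.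
exact: continuous_projection.
Qed.

Definition borel (s : sidedness) (p : nat) : Type :=
  g_sigma_algebraType (@open (fullshift s p)).

HB.instance Definition _ s p := Measurable.on (borel s p).

Lemma measurable_iter_shift s p k :
  measurable_fun [set: borel s p] (iter k (@left_shift s p) : borel s p -> borel s p).
Proof.
apply: (@measurability _ _ (borel s p) (borel s p) _ _ (@open (fullshift s p))) => // _ [B oB <-].
rewrite setTI; apply: sub_sigma_algebra; apply: open_comp => // x _.
elim: k => [|k IH] /=; first exact: cvg_id.
exact: (continuous_comp IH (@continuous_shift s p _)).
Qed.

Section measures.
Variables (R : realType) (s : sidedness) (p : nat).
Local Notation T := (borel s p).
Local Open Scope ereal_scope.

Definition empirical (E : {fset fullshift s p}) (A : set T) : \bar R :=
  ((#|` E|%:R)^-1)%:E * \sum_(x <- E) \d_(x : T) A.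

Let empirical_msum E : empirical E =
  mscale ((#|` E|%:R^-1 : R)%:nng)%R
    (msum (fun i => @dirac _ T (nth point (E : seq T) i) R) #|` E|).
Proof.
apply/funext => A; rewrite /mscale /msum /empirical /=; congr (_ * _).
by rewrite (big_nth point) big_mkord.
Qed.

Let empirical0 E : empirical E set0 = 0.
Proof. by rewrite empirical_msum measure0. Qed.
Let empirical_ge0 E A : 0 <= empirical E A.
Proof. by rewrite empirical_msum measure_ge0. Qed.
Let empirical_sigma_additive E : semi_sigma_additive (empirical E).
Proof. by rewrite empirical_msum; exact: measure_semi_sigma_additive. Qed.

HB.instance Definition _ E := isMeasure.Build _ _ _ (empirical E)
  (empirical0 E) (empirical_ge0 E) (@empirical_sigma_additive E).

Definition orbit_average (nu : {measure set T -> \bar R}) (n : nat)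
    (A : set T) : \bar R :=
  ((n%:R)^-1)%:E *
    \sum_(k < n) pushforward nu (iter k (@left_shift s p) : T -> T) A.

Section orbit_average_measure.
Variables (nu : {measure set T -> \bar R}) (n : nat).

Let orbit_average_msum : orbit_average nu n =
  mscale ((n%:R^-1 : R)%:nng)%R
    (msum (fun k => measure_function_pushforward__canonical__measure_function_Measure
        nu (@measurable_iter_shift s p k)) n).
Proof. by []. Qed.

Let orbit_average0 : orbit_average nu n set0 = 0.
Proof. by rewrite orbit_average_msum measure0. Qed.
Let orbit_average_ge0 A : 0 <= orbit_average nu n A.
Proof. by rewrite orbit_average_msum measure_ge0. Qed.
Let orbit_average_sigma_additive : semi_sigma_additive (orbit_average nu n).
Proof. by rewrite orbit_average_msum; exact: measure_semi_sigma_additive. Qed.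

HB.instance Definition _ := isMeasure.Build _ _ _ (orbit_average nu n)
  orbit_average0 orbit_average_ge0 orbit_average_sigma_additive.

End orbit_average_measure.

(* Borel measures on X are measures on the full shift giving full mass to X;
   C(X) consists of the restrictions to X of the functions tested here. *)
Definition weak_star_cvg (X : set (fullshift s p))
    (m : nat -> {measure set T -> \bar R}) (mu : {measure set T -> \bar R}) :=
  forall f : fullshift s p -> R, {within X, continuous f} ->
    \int[m k]_(x in X) (f x)%:E @[k --> \oo] --> \int[mu]_(x in X) (f x)%:E.

Definition one_point_per_cylinder (X : set (fullshift s p)) (n : nat)
    (E : {fset fullshift s p}) :=
  (forall x, x \in E -> X x) /\
  forall w, language X w -> size w = n ->
    exists! x, x \in E /\ central_cylinder X w x.

Definition limit_measure (X : set (fullshift s p))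
    (E : nat -> {fset fullshift s p}) (mu : probability T R) :=
  mu X = 1 /\
  exists phi : nat -> nat, {homo phi : i j / (i < j)%N} /\
    weak_star_cvg X (fun k => orbit_average (empirical (E (phi k))) (phi k)) mu.

End measures.

(* Main.v *)
(* Write h for h(L). Gluing m words of G_n with gaps of length t gives
   (#G_n)^m <= #L_{m(n+t)}, hence #G_n <= e^{h(n+t)}. Since the prefixes and
   suffixes have entropy below h, summing #C_i #G_{n-i-k} #C_k over i + k >= M
   costs at most K r^M e^{nh} with r < 1: for M = 0 this bounds #L_n from
   above, and for M large, against the Fekete bound #L_n >= e^{nh}, it shows
   #G(M)_n >= e^{nh}/2.
   For w in G(M)_n and N large, glue every u in G(M0)_a and v in G(M0)_b around
   w, where a + b is about N - n. The gaps have variable lengths, so w does not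
   land at a prescribed place, and in a one-sided shift the result cannot be
   corrected by prepending letters. Summing over a removes the problem: only
   the total number of occurrences of w in words of L_N matters for mu_N([w]),
   and it is at least a constant times N e^{(N-n)h}. *)
Require Import Defs.
From mathcomp Require Import all_boot all_order all_algebra finmap.
From mathcomp Require Import all_classical all_reals all_analysis.
From mathcomp Require Import zify ring lra.

Set Implicit Arguments.
Unset Strict Implicit.
Unset Printing Implicit Defensive.

Import Order.TTheory GRing.Theory Num.Theory.
Import numFieldNormedType.Exports.

Local Open Scope classical_set_scope.
Local Open Scope ring_scope.

Lemma leq_card_cover (I T : finType) (S : I -> finType) (F : forall i, {pred S i})
    (f : forall i, S i -> T) (A : {pred T}) :
  (forall x, x \in A -> exists i (y : S i), y \in F i /\ f i y = x) ->
  (#|A| <= \sum_i #|F i|)%N.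
Proof.
move=> cov.
apply: (@leq_trans (\sum_(x in A) \sum_i (x \in [seq f i y | y in F i]))%N).
  rewrite -sum1_card; apply: leq_sum => x /cov [i [y [Fy <-]]].
  by rewrite (bigD1 i)//= map_f ?mem_enum// add1n.
rewrite exchange_big/=; apply: leq_sum => i _.
apply: leq_trans (leq_image_card (f i) (F i)).
by rewrite -sum1_card [leqRHS]big_mkcond [leqLHS]big_mkcond/=; apply: leq_sum => x _;
  case: (x \in A) => //; case: (_ \in _).
Qed.

Definition tuple_of_word p n (w : word p) : n.-tuple 'I_p.+1 :=
  insubd (nseq_tuple n ord0) w.

Lemma tuple_of_wordK p n (w : word p) : size w = n -> tuple_of_word n w = w :> word p.
Proof. by move=> sw; rewrite val_insubd sw eqxx. Qed.

Lemma nb_words_cover p (D : set (word p)) n (I : finType) (S : I -> finType)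
    (F : forall i, {pred S i}) (f : forall i, S i -> word p) :
  (forall x, D x -> size x = n -> exists i (y : S i), y \in F i /\ f i y = x) ->
  (nb_words D n <= \sum_i #|F i|)%N.
Proof.
move=> cov; apply: (leq_card_cover (f := fun i y => tuple_of_word n (f i y))) => x.
rewrite inE => Dx; have [i [y [Fy fy]]] := cov _ Dx (size_tuple x).
by exists i, y; split=> //; apply: val_inj => /=; rewrite fy tuple_of_wordK ?size_tuple.
Qed.

Lemma nb_words_expn p (D : set (word p)) n : (nb_words D n <= p.+1 ^ n)%N.
Proof. by apply: leq_trans (max_card _) _; rewrite card_tuple card_ord. Qed.

Lemma nb_words_gt0 p (D : set (word p)) w : D w -> (0 < nb_words D (size w))%N.
Proof. by move=> Dw; apply/card_gt0P; exists (in_tuple w); rewrite inE. Qed.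

Lemma nb_words_setUC p (D D' : set (word p)) n :
  (nb_words D n <= nb_words D' n + nb_words (D `\` D') n)%N.
Proof.
rewrite -[leqRHS]cardUI; apply: leq_trans (leq_addr _ _).
apply: subset_leq_card; apply/fintype.subsetP => x; rewrite !inE => Dx.
case: (pselect (D' x)) => D'x; first by rewrite (asboolT D'x).
by apply/orP; right; apply: asboolT.
Qed.

Lemma nb_words_factors p (D C G : set (word p)) n M :
  (forall x, D x -> size x = n -> exists u v w,
     [/\ x = u ++ v ++ w, C u, G v, C w & (M <= size u + size w)%N]) ->
  (nb_words D n <= \sum_(i < n.+1) \sum_(k < n.+1 | (M <= i + k <= n)%N)
     nb_words C i * nb_words G (n - i - k) * nb_words C k)%N.
Proof.
move=> dec; rewrite pair_big_dep/= big_mkcond/=.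
pose W (D' : set (word p)) i := [pred w : i.-tuple 'I_p.+1 | `[< D' (tval w) >]].
pose S (q : 'I_n.+1 * 'I_n.+1) : finType :=
  (q.1.-tuple 'I_p.+1 * (n - q.1 - q.2).-tuple 'I_p.+1 * q.2.-tuple 'I_p.+1)%type.
pose F (q : 'I_n.+1 * 'I_n.+1) : {pred S q} :=
  if (M <= q.1 + q.2 <= n)%N
  then [predX [predX W C q.1 & W G (n - q.1 - q.2)%N] & W C q.2] else pred0.
pose f q (y : S q) : word p := tval y.1.1 ++ tval y.1.2 ++ tval y.2.
have /nb_words_cover/leq_trans : forall x, D x -> size x = n ->
    exists q (y : S q), y \in F q /\ f q y = x.
  move=> x Dx sx; have [u [v [w [xE Cu Gv Cw Muw]]]] := dec x Dx sx.
  have := sx; rewrite xE !size_cat => suvw.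
  have su : (size u < n.+1)%N by lia.
  have sw : (size w < n.+1)%N by lia.
  have sv : size v = (n - size u - size w)%N by lia.
  exists (Ordinal su, Ordinal sw), (in_tuple u, tuple_of_word _ v, in_tuple w).
  rewrite /f/= tuple_of_wordK//; split=> //.
  rewrite /F/= ifT; last lia.
  by rewrite !inE/= tuple_of_wordK//; rewrite !asboolT.
apply; apply: leq_sum => q _; rewrite /F; case: ifP => _; last by rewrite card0.
by rewrite !cardX.
Qed.

Lemma size_glue p m n t (w : 'I_m.+1 -> word p) (v : 'I_m -> word p) :
  (forall i, size (w i) = n) -> (forall i, size (v i) = t) ->
  size (w ord0 ++ \big[cat/[::]]_(i < m) (v i ++ w (lift ord0 i))) =
  (n + m * (n + t))%N.
Proof.
move=> sw sv; rewrite size_cat sw; congr addn.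
rewrite (big_morph (@size _) (@size_cat _) (erefl _)).
rewrite (eq_bigr (fun=> (n + t)%N)) ?sum_nat_const ?card_ord// => i _.
by rewrite size_cat sw sv addnC.
Qed.

Lemma take_drop_glue p m n t (w : 'I_m.+1 -> word p) (v : 'I_m -> word p) (r : word p)
    (i : 'I_m.+1) :
  (forall i, size (w i) = n) -> (forall i, size (v i) = t) ->
  take n (drop (i * (n + t))
    ((w ord0 ++ \big[cat/[::]]_(i < m) (v i ++ w (lift ord0 i))) ++ r)) = w i.
Proof.
elim: m w v i => [|m IH] w v i sw sv.
  by rewrite ord1 mul0n drop0 -catA take_size_cat.
case: (unliftP ord0 i) => [j|] ->; last by rewrite mul0n drop0 -catA take_size_cat.
rewrite big_ord_recl/= /bump/= add1n mulSn addnC -drop_drop.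
have -> : forall a b c d e : word p, ((a ++ (b ++ c) ++ d) ++ e) = (a ++ b) ++ ((c ++ d) ++ e).
  by move=> a b c d e; rewrite !catA.
rewrite drop_size_cat ?size_cat ?sw ?sv//.
by rewrite (IH (fun i => w (lift ord0 i)) (fun i => v (lift ord0 i))).
Qed.

Section Language.
Variables (s : sidedness) (p : nat) (X : set (fullshift s p)).
Local Notation L := (language X).

Lemma advanceD (i : position s) j k : advance (advance i j) k = advance i (j + k).
Proof. by case: s i => i /=; rewrite ?addnA// PoszD addrA. Qed.

Lemma size_subword (x : fullshift s p) i n : size (subword x i n) = n.
Proof. exact: size_mkseq. Qed.

Lemma take_drop_subword (x : fullshift s p) i n j k : (j + k <= n)%N ->
  take k (drop j (subword x i n)) = subword x (advance i j) k.
Proof.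
move=> jkn; apply: (@eq_from_nth _ ord0).
  by rewrite size_takel ?size_drop !size_subword; lia.
rewrite size_takel ?size_drop ?size_subword; last lia.
move=> l lk.
by rewrite nth_take// nth_drop !nth_mkseq ?advanceD//; lia.
Qed.

Lemma language_subword x i n : X x -> L (subword x i n).
Proof. by move=> Xx; exists x => //; exists i; rewrite size_subword. Qed.

Lemma language_factor u v w : L (u ++ v ++ w) -> L v.
Proof.
move=> [x Xx [i xi]]; exists x => //; exists (advance i (size u)).
rewrite -(@take_drop_subword x i (size (u ++ v ++ w))); last by rewrite !size_cat; lia.
by rewrite xi drop_size_cat// take_size_cat.
Qed.

Lemma language_take_drop j k u : L u -> L (take k (drop j u)).
Proof.
by move=> Lu; apply: (@language_factor (take j u) _ (drop k (drop j u)));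
  rewrite !cat_take_drop.
Qed.

Lemma subwordD (x : fullshift s p) i m n :
  subword x i (m + n) = subword x i m ++ subword x (advance i m) n.
Proof.
rewrite /subword /mkseq iotaD map_cat add0n -[X in iota X n]addn0 iotaDl -map_comp.
by congr (_ ++ _); apply: eq_map => j /=; rewrite advanceD.
Qed.

Lemma language_extend_right k u : L u -> exists2 v, size v = k & L (u ++ v).
Proof.
move=> [x Xx [i xi]]; exists (subword x (advance i (size u)) k).
  exact: size_subword.
by rewrite -{1}xi -subwordD; exact: language_subword.
Qed.

Lemma nb_language_gt0 n : X !=set0 -> (0 < nb_words L n)%N.
Proof.
move=> [x Xx]; pose i : position s := cylinder_start s 0.
by have := nb_words_gt0 (language_subword i n Xx); rewrite size_subword.
Qed.

Lemma nb_language_add m n : (nb_words L (m + n) <= nb_words L m * nb_words L n)%N.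
Proof.
pose W i := [pred w : i.-tuple 'I_p.+1 | `[< L (tval w) >]].
have /nb_words_cover/leq_trans : forall x, L x -> size x = (m + n)%N ->
    exists (i : 'I_1) (y : m.-tuple 'I_p.+1 * n.-tuple 'I_p.+1),
      y \in [predX W m & W n] /\ tval y.1 ++ tval y.2 = x.
  move=> x Lx sx; exists ord0, (tuple_of_word m (take m x), tuple_of_word n (drop m x)) => /=.
  rewrite !tuple_of_wordK ?cat_take_drop ?size_takel ?size_drop; [|lia..].
  split=> //; rewrite !inE/= !tuple_of_wordK ?size_takel ?size_drop; [|lia..].
  apply/andP; split; apply: asboolT; first by have := language_take_drop 0 m Lx; rewrite drop0.
  by rewrite -[drop m x](@take_oversize _ n) ?size_drop ?sx ?addKn//; exact: language_take_drop.
by apply; rewrite big_ord1 cardX.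
Qed.

Lemma nb_words_glue G t n m :
  (forall (m : nat) (w : 'I_m.+1 -> word p), (forall i, G (w i)) ->
    exists v : 'I_m -> word p, (forall i, L (v i) /\ size (v i) = t) /\
      L (w ord0 ++ \big[cat/[::]]_(i < m) (v i ++ w (lift ord0 i)))) ->
  (nb_words G n ^ m.+1 <= nb_words L (m.+1 * (n + t)))%N.
Proof.
move=> spec.
pose W D i := [pred w : i.-tuple 'I_p.+1 | `[< D (tval w) >]].
rewrite -[X in (_ ^ X)%N](card_ord m.+1) -(card_ffun_on 'I_m.+1 (W G n)).
pose f (z : (m.+1 * (n + t)).-tuple 'I_p.+1) : {ffun 'I_m.+1 -> n.-tuple 'I_p.+1} :=
  [ffun i : 'I_m.+1 => tuple_of_word n (take n (drop (i * (n + t)) z))].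
have /leq_card_cover/leq_trans : forall g, g \in ffun_on (W G n) ->
    exists (i : 'I_1) z, z \in W L (m.+1 * (n + t))%N /\ f z = g.
  move=> g /ffun_onP Wg.
  have [|v [Lv Lz]] := spec m (fun i => g i); first by move=> i; exact/asboolP/Wg.
  have sv i : size (v i) = t by case: (Lv i).
  have [r sr Lr] := language_extend_right t Lz.
  have sg i : size (g i) = n by rewrite size_tuple.
  exists ord0, (tuple_of_word _ ((g ord0 ++ \big[cat/[::]]_(i < m) (v i ++ g (lift ord0 i))) ++ r)).
  have sz : size ((g ord0 ++ \big[cat/[::]]_(i < m) (v i ++ g (lift ord0 i))) ++ r) =
      (m.+1 * (n + t))%N.
    by rewrite size_cat sr (size_glue (n := n) (t := t) (w := fun i => g i)) //; lia.
  rewrite inE/= tuple_of_wordK//; split=> //.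
  apply/ffunP => i; apply: val_inj; rewrite ffunE tuple_of_wordK//.
  by rewrite (take_drop_glue r i (w := fun i => g i) (v := v) (n := n) (t := t))//
    [LHS]tuple_of_wordK.
by apply; rewrite big_ord1.
Qed.

End Language.

Section Entropy.
Variables (R : realType) (p : nat).
Implicit Types D : set (word p).

Lemma word_entropy_lt_bound D (x : R) : (word_entropy R D < x%:E)%E ->
  exists N, forall n, (N <= n)%N -> (nb_words D n)%:R <= expR (n%:R * x).
Proof.
move=> /ereal_inf_lt[_ [V [N _ VN] <-] supV]; exists N.+1 => n Nn.
have n0 : (0 < n%:R :> R) by rewrite ltr0n; apply: leq_trans Nn.
have Vn : V n by apply: VN => /=; exact: ltnW.
have [->|nb0] := posnP (nb_words D n); first exact: expR_ge0.
have nbR : (0 < (nb_words D n)%:R :> R) by rewrite ltr0n.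
have : (n%:R^-1%:E * lne (nb_words D n)%:R%:E <= x%:E)%E.
  by apply/ltW/(le_lt_trans _ supV); apply: ereal_sup_ubound; exists n.
rewrite lne_EFin// -EFinM lee_fin ler_pdivrMl// => lnx.
by rewrite -[leLHS](@lnK R) ?posrE// ler_expR.
Qed.

Lemma word_entropy_le_bound D (x : R) N :
  (forall n, (N <= n)%N -> (nb_words D n)%:R <= expR (n%:R * x)) ->
  (word_entropy R D <= x%:E)%E.
Proof.
move=> bd; apply: (@le_trans _ _ (ereal_sup [set (n%:R^-1%:E * lne (nb_words D n)%:R%:E)%E
    | n in [set n | (N.+1 <= n)%N]])).
  apply: ereal_inf_lbound; exists [set n | (N.+1 <= n)%N] => //.
  by exists N.+1.
apply: ge_ereal_sup => _ [n /= Nn <-].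
have n0 : (0 < n%:R :> R) by rewrite ltr0n; apply: leq_trans Nn.
have [->|nb0] := posnP (nb_words D n).
  by rewrite lexx gt0_muleNy ?leNye// lte_fin invr_gt0.
have nbR : (0 < (nb_words D n)%:R :> R) by rewrite ltr0n.
rewrite (lt_geF nbR) -EFinM lee_fin ler_pdivrMl//.
by rewrite -ler_expR lnK ?posrE//; apply/bd/ltnW.
Qed.

Lemma word_entropy_ltey D : (word_entropy R D < +oo)%E.
Proof.
apply: (@le_lt_trans _ _ (ln p.+1%:R : R)%:E); last exact: ltey.
apply: (@word_entropy_le_bound _ _ 0) => n _.
by rewrite expRM_natl lnK ?posrE ?ltr0n// -natrX ler_nat nb_words_expn.
Qed.

Lemma word_entropy_lt_geometric D (h : R) : (word_entropy R D < h%:E)%E ->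
  exists A r : R, [/\ 0 < A, 0 < r < 1 &
    forall n, (nb_words D n)%:R <= A * r ^+ n * r ^+ n * expR (n%:R * h)].
Proof.
move=> Dh.
have [h' [Dh' h'h]] : exists h' : R, (word_entropy R D < h'%:E)%E /\ h' < h.
  case: (word_entropy R D) Dh (word_entropy_ltey D) => [x| |]//.
    rewrite lte_fin => xh _; exists ((x + h) / 2); rewrite lte_fin; split; lra.
  by move=> _ _; exists (h - 1); rewrite ltNyr; split=> //; lra.
have [N bd] := word_entropy_lt_bound Dh'.
pose r := expR ((h' - h) / 2).
have rE n : r ^+ n * r ^+ n * expR (n%:R * h) = expR (n%:R * h').
  rewrite /r -!expRM_natl -!expRD; congr expR; lra.
pose A := 1 + \sum_(k < N) (nb_words D k)%:R * expR (- (k%:R * h')).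
have S0 P : 0 <= \sum_(k < N | P k) (nb_words D k)%:R * expR (- (k%:R * h')).
  by apply: sumr_ge0 => k _; rewrite mulr_ge0 ?expR_ge0.
have A1 : 1 <= A by rewrite /A lerDl S0.
exists A; exists r; split.
- exact: lt_le_trans A1.
- by rewrite expR_gt0 expR_lt1; lra.
move=> n; rewrite -!mulrA [r ^+ n * _]mulrA rE.
have [nN|/bd nb] := ltnP n N; last first.
  by apply: le_trans nb _; rewrite ler_peMl ?expR_ge0.
rewrite -ler_pdivrMr ?expR_gt0// -expRN /A (bigD1 (Ordinal nN))//= addrCA lerDl.
by rewrite addr_ge0// S0.
Qed.

Lemma ler_expR_eps (a : R) (x c : R) : 0 <= c ->
  (forall e, 0 < e -> a <= expR (c * (x + e))) -> a <= expR (c * x).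
Proof.
move=> c0 H; have [a0|a0] := leP a 0; first exact: le_trans (expR_ge0 _).
rewrite -[a](@lnK R) ?posrE// ler_expR.
apply/ler_addgt0Pr => e e0.
have := H (e / (c + 1)); rewrite divr_gt0//; last by lra.
move=> /(_ isT); rewrite -{1}[a](@lnK R) ?posrE// ler_expR => /le_trans; apply.
rewrite mulrDr lerD2l mulrA ler_pdivrMr; last by lra.
nra.
Qed.

Variables (s : sidedness) (X : set (fullshift s p)).
Local Notation L := (language X).

Lemma nb_language_ge (h : R) n : X !=set0 -> word_entropy R L = h%:E ->
  expR (n%:R * h) <= (nb_words L n)%:R.
Proof.
move=> X0 hE; have [->|n0] := posnP n.
  by rewrite mul0r expR0 ler1n nb_language_gt0.
have nR : (0 < n%:R :> R) by rewrite ltr0n.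
have lR k : (1 <= (nb_words L k)%:R :> R) by rewrite ler1n nb_language_gt0.
pose h' := ln (nb_words L n)%:R / n%:R : R.
have h'0 : 0 <= h' by rewrite divr_ge0 ?ln_ge0// ltW.
have nh' : expR (n%:R * h') = (nb_words L n)%:R.
  by rewrite /h' mulrC divfK ?gt_eqF// lnK// posrE (lt_le_trans ltr01).
rewrite -nh' ler_expR ler_pM2l//.
apply/ler_addgt0Pr => e e0; rewrite -lee_fin -hE.
pose B : R := (p.+1 ^ n)%:R.
have B1 : 1 <= B by rewrite ler1n expn_gt0.
pose N := Num.bound (ln B / e).
apply: (@word_entropy_le_bound _ _ N) => k Nk.
have lB : (nb_words L k)%:R <= expR (k%:R * h') * B.
  have mulL q j : (nb_words L (q * n + j) <= nb_words L n ^ q * nb_words L j)%N.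
    elim: q => [|q IH]; first by rewrite mul0n add0n expn0 mul1n.
    rewrite mulSn -addnA expnS -mulnA.
    by apply: leq_trans (nb_language_add X _ _) _; rewrite leq_mul2l IH orbT.
  rewrite {1}(divn_eq k n).
  apply: le_trans (_ : ((nb_words L n ^ (k %/ n)) * nb_words L (k %% n))%:R <= _).
    by rewrite ler_nat mulL.
  rewrite natrM ler_pM//.
    rewrite natrX -nh' -expRM_natl ler_expR mulrA ler_wpM2r// -natrM ler_nat.
    exact: leq_trunc_div.
  rewrite ler_nat; apply: leq_trans (nb_words_expn _ _) _.
  by rewrite leq_pexp2l// ltnW// ltn_pmod.
apply: le_trans lB _; rewrite mulrDr expRD ler_wpM2l ?expR_ge0//.
rewrite -[B](@lnK R) ?posrE ?(lt_le_trans ltr01)// ler_expR.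
rewrite -ler_pdivrMr//; apply: le_trans (_ : N%:R <= _); last by rewrite ler_nat.
by apply/ltW/archi_boundP; rewrite divr_ge0 ?ln_ge0// ltW.
Qed.

End Entropy.

Lemma sum_geometric_le (R : realType) (r : R) n : 0 < r < 1 ->
  \sum_(i < n) r ^+ i <= (1 - r)^-1.
Proof.
move=> /andP[r0 r1]; rewrite -[leRHS]mul1r ler_pdivlMr ?subr_gt0//.
rewrite -opprB mulrN mulrC -subrX1 opprB gerBl exprn_ge0// ltW//.
Qed.

Section Counting.
Variables (R : realType) (s : sidedness) (p : nat) (X : set (fullshift s p)).
Variables (Cp G Cs : set (word p)) (h : R).
Local Notation L := (language X).

Lemma nb_words_spec_le t n :
  (forall (m : nat) (w : 'I_m.+1 -> word p), (forall i, G (w i)) ->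
    exists v : 'I_m -> word p, (forall i, L (v i) /\ size (v i) = t) /\
      L (w ord0 ++ \big[cat/[::]]_(i < m) (v i ++ w (lift ord0 i)))) ->
  word_entropy R L = h%:E ->
  (nb_words G n)%:R <= expR ((n + t)%:R * h).
Proof.
move=> spec hE; have [nt0|nt0] := posnP (n + t).
  have n0 : n = 0%N by lia.
  by rewrite nt0 mul0r expR0 n0 lern1 (leq_trans (nb_words_expn _ _)).
apply: ler_expR_eps; first exact: ler0n.
move=> e e0; have [|N bd] := @word_entropy_lt_bound R p L (h + e).
  by rewrite hE lte_fin; lra.
have := bd (N.+1 * (n + t))%N; rewrite (leq_trans (leqnSn N)) ?leq_pmulr// => /(_ isT).
have := @nb_words_glue s p X G t n N spec; rewrite -(ler_nat R) natrX => /le_trans H /H.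
by rewrite natrM -mulrA expRM_natl ler_pXn2r ?nnegrE ?ler0n ?expR_ge0.
Qed.

Lemma nb_words_factors_le (A B r : R) (C D : set (word p)) M n :
  0 < A -> 0 < B -> 0 < r < 1 ->
  (forall n, (nb_words C n)%:R <= A * r ^+ n * r ^+ n * expR (n%:R * h)) ->
  (forall n, (nb_words G n)%:R <= B * expR (n%:R * h)) ->
  (forall x, D x -> size x = n -> exists u v w,
     [/\ x = u ++ v ++ w, C u, G v, C w & (M <= size u + size w)%N]) ->
  (nb_words D n)%:R <= A * A * B * ((1 - r)^-1) ^+ 2 * r ^+ M * expR (n%:R * h).
Proof.
move=> A0 B0 r01 Cle Gle /nb_words_factors; rewrite -(ler_nat R) => /le_trans; apply.
have /andP[r0 r1] := r01.
pose K := A * A * B * r ^+ M * expR (n%:R * h).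
have K0 : 0 <= K by rewrite !mulr_ge0 ?exprn_ge0 ?expR_ge0// ltW.
have S0 : 0 <= \sum_(i < n.+1) r ^+ i by apply: sumr_ge0 => i _; rewrite exprn_ge0// ltW.
apply: (@le_trans _ _ (\sum_(i < n.+1) \sum_(k < n.+1) K * r ^+ i * r ^+ k)).
  rewrite natr_sum; apply: ler_sum => i _; rewrite natr_sum big_mkcond/=.
  apply: ler_sum => k _; case: ifP => [/andP[Mik ikn]|_]; last first.
    by rewrite mulr_ge0 ?exprn_ge0 ?(ltW r0)// mulr_ge0// exprn_ge0// ltW.
  rewrite !natrM.
  apply: le_trans (_ : (A * r ^+ i * r ^+ i * expR (i%:R * h)) *
     (B * expR ((n - i - k)%:R * h)) * (A * r ^+ k * r ^+ k * expR (k%:R * h)) <= _).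
    by rewrite ler_pM// ?mulr_ge0 ?ler_pM.
  have -> : (A * r ^+ i * r ^+ i * expR (i%:R * h)) *
     (B * expR ((n - i - k)%:R * h)) * (A * r ^+ k * r ^+ k * expR (k%:R * h)) =
     A * A * B * (r ^+ i * r ^+ k) * (expR (i%:R * h) * expR (k%:R * h)
        * expR ((n - i - k)%:R * h)) * r ^+ i * r ^+ k by ring.
  rewrite -exprD -!expRD -!mulrDl -!natrD.
  have -> : (i + k + (n - i - k) = n)%N by lia.
  have [[r0' A0'] B0'] := (ltW r0, ltW A0, ltW B0).
  rewrite /K !ler_wpM2r ?exprn_ge0 ?expR_ge0// ler_wpM2l ?mulr_ge0//.
  by rewrite ler_wiXn2l// ltW.
under eq_bigr do rewrite -mulr_sumr.
rewrite -mulr_suml -mulr_sumr /K.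
have S1 := sum_geometric_le n.+1 r01.
have -> : A * A * B * (1 - r)^-1 ^+ 2 * r ^+ M * expR (n%:R * h) =
  K * (1 - r)^-1 * (1 - r)^-1 by rewrite /K expr2; ring.
rewrite -/K; apply: ler_pM => //; first by rewrite mulr_ge0.
by rewrite ler_wpM2l.
Qed.


Lemma nb_words_bounds :
  X !=set0 -> decomposition L Cp G Cs -> specification L G ->
  (word_entropy R (Cp `|` Cs) < h%:E)%E -> word_entropy R L = h%:E ->
  (exists2 C : R, 0 < C & forall n, (nb_words L n)%:R <= C * expR (n%:R * h)) /\
  (exists M, forall n,
     expR (n%:R * h) / 2 <= (nb_words (enlarge L Cp G Cs M) n)%:R).
Proof.
move=> X0 [_ _ _ dec] [t spec] hC hE.
have [A [r [A0 r01 Cle]]] := word_entropy_lt_geometric hC.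
have Gle n : (nb_words G n)%:R <= expR (t%:R * h) * expR (n%:R * h).
  by rewrite -expRD -mulrDl -natrD addnC; exact: nb_words_spec_le.
have /andP[r0 r1] := r01.
pose K := A * A * expR (t%:R * h) * ((1 - r)^-1) ^+ 2.
have K0 : 0 < K by rewrite !mulr_gt0 ?exprn_gt0 ?invr_gt0 ?subr_gt0 ?expR_gt0.
have bd := nb_words_factors_le A0 (expR_gt0 _) r01 Cle Gle.
split.
  exists K => // n; have := bd L 0%N n; rewrite expr0 mulr1; apply => x Lx _.
  have [u [v [w [Cu Gv Cw ->]]]] := dec x Lx.
  by exists u, v, w; split=> //; [left|right].
have [M rM] : exists M, K * r ^+ M <= 2^-1.
  have /cvgrPdist_lt/(_ (2 * K)^-1) : r ^+ n @[n --> \oo] --> 0.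
    by apply: cvg_expr; rewrite ger0_norm// ltW.
  rewrite invr_gt0 mulr_gt0// => /(_ isT).
  move=> [M _ /(_ M (leqnn M))]; rewrite /= sub0r normrN ger0_norm ?exprn_ge0 ?ltW// => rM.
  exists M; rewrite mulrC -ler_pdivlMr//; apply/ltW.
  by rewrite -invfM.
exists M => n; pose D := enlarge L Cp G Cs M.
have := @nb_words_setUC p L D n; rewrite -(ler_nat R) natrD => LD.
have ge := nb_language_ge n X0 hE.
suff : (nb_words (L `\` D) n)%:R <= 2^-1 * expR (n%:R * h).
  rewrite -/D; lra.
apply: (@le_trans _ _ (K * r ^+ M * expR (n%:R * h))); last first.
  by rewrite ler_wpM2r ?expR_ge0.
apply: bd => x [Lx nDx] _; have [u [v [w [Cu Gv Cw xE]]]] := dec x Lx.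
exists u, v, w; split=> //; [by left|by right|].
rewrite leqNgt; apply/negP => uw; apply: nDx; split=> //.
by exists u, v, w; split=> //; lia.
Qed.

End Counting.

Definition occurrences p (D : set (word p)) (w : word p) (j : nat) : set (word p) :=
  [set z | D z /\ take (size w) (drop j z) = w].

Section Occurrences.
Variables (s : sidedness) (p : nat) (X : set (fullshift s p)).
Local Notation L := (language X).
Implicit Types (Cp G Cs D : set (word p)) (u v w : word p).

Lemma enlarge_glue Cp G Cs M N :
  specification L G -> extendable L Cp G Cs ->
  exists T, forall u v w, enlarge L Cp G Cs N u -> enlarge L Cp G Cs N v ->
    enlarge L Cp G Cs M w ->
    exists x y, [/\ (size x <= T)%N, (size y <= T)%N & L (u ++ x ++ w ++ y ++ v)].
Proof.
move=> [t spec] ext; have [tM extM] := ext M; have [tN extN] := ext N.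
exists (tN + t + tM)%N => u v w /extN[u1 [u2 [su1 su2 Gu]]].
move=> /extN[v1 [v2 [sv1 sv2 Gv]]] /extM[w1 [w2 [sw1 sw2 Gw]]].
pose g (i : 'I_3) : word p :=
  nth [::] [:: u1 ++ u ++ u2; w1 ++ w ++ w2; v1 ++ v ++ v2] i.
have [|z [Lz]] := spec 2%N g.
  by move=> [[|[|[|//]]] ?].
rewrite !big_ord_recl big_ord0 /g/= cats0 => Lg.
have [[_ sz0] [_ sz1]] := (Lz ord0, Lz (lift ord0 ord0)).
exists (u2 ++ z ord0 ++ w1), (w2 ++ z (lift ord0 ord0) ++ v1).
rewrite !size_cat sz0 sz1; split; [lia|lia|].
apply: (@language_factor _ _ X u1 _ v2); move: Lg.
by rewrite !catA.
Qed.

Lemma nb_words_glue_occurrences D T w a b :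
  (forall u v, D u -> D v ->
    exists x y, [/\ (size x <= T)%N, (size y <= T)%N & L (u ++ x ++ w ++ y ++ v)]) ->
  (nb_words D a * nb_words D b <=
   T.+1 * \sum_(e < T.+1) nb_words (occurrences L w (a + e)) (a + b + size w + 2 * T))%N.
Proof.
move=> glue; pose N := (a + b + size w + 2 * T)%N.
pose W D' i := [pred z : i.-tuple 'I_p.+1 | `[< D' (tval z) >]].
pose f (ef : 'I_T.+1 * 'I_T.+1) (z : N.-tuple 'I_p.+1) :=
  (tuple_of_word a (take a z),
   tuple_of_word b (take b (drop (a + ef.1 + size w + ef.2) z))).
have /leq_card_cover/leq_trans : forall uv, uv \in [predX W D a & W D b] ->
    exists (ef : 'I_T.+1 * 'I_T.+1) z, z \in W (occurrences L w (a + ef.1)%N) N /\ f ef z = uv.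
  move=> [u v]; rewrite !inE/= => /andP[/asboolW Du /asboolW Dv].
  have [x [y [xT yT Lz]]] := glue _ _ Du Dv.
  have [r sr Lzr] := language_extend_right ((T - size x) + (T - size y)) Lz.
  have su := size_tuple u; have sv := size_tuple v.
  have sN : size ((tval u ++ x ++ w ++ y ++ tval v) ++ r) = N.
    by rewrite !size_cat sr su sv /N; lia.
  exists (Ordinal (xT : (size x < T.+1)%N), Ordinal (yT : (size y < T.+1)%N)).
  exists (tuple_of_word N ((tval u ++ x ++ w ++ y ++ tval v) ++ r)).
  rewrite inE/= /f/= !tuple_of_wordK//; split.
    split=> //; have -> : (tval u ++ x ++ w ++ y ++ tval v) ++ r =
      (tval u ++ x) ++ w ++ (y ++ tval v ++ r) by rewrite !catA.
    by rewrite drop_size_cat ?size_cat ?su// take_size_cat.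
  congr pair; apply: val_inj => /=.
    by rewrite -!catA take_size_cat ?su// tuple_of_wordK.
  have -> : (tval u ++ x ++ w ++ y ++ tval v) ++ r =
      (tval u ++ x ++ w ++ y) ++ tval v ++ r by rewrite !catA.
  by rewrite drop_size_cat ?size_cat ?su ?addnA// take_size_cat// tuple_of_wordK.
rewrite cardX; apply.
rewrite -(pair_big xpredT xpredT (fun e _ => #|W (occurrences L w (a + nat_of_ord e)%N) N|))/=.
by rewrite big_distrr/=; apply: leq_sum => e _; rewrite sum_nat_const card_ord.
Qed.

Lemma sum_shift_le (f : nat -> nat) (P : pred nat) e m N :
  (forall k, (k < m)%N -> (k + e < N)%N && P (k + e)%N) ->
  (\sum_(k < m) f (k + e) <= \sum_(k < N | P k) f k)%N.
Proof.
move=> H; case: m H => [|m] H; first by rewrite big_ord0.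
have /andP[meN _] := H m (ltnSn m).
rewrite -(big_mkord xpredT (fun k => f (k + e)%N)) -(big_mkord P f).
have := big_addn 0 (m.+1 + e) e xpredT f.
rewrite add0n addnK => <-.
rewrite (@big_cat_nat _ _ _ e 0 N P f)/=; [|lia..].
rewrite (@big_cat_nat _ _ _ (m.+1 + e) e N P f)/=; [|lia..].
rewrite (big_nat_cond _ _ e _ P) (big_nat_cond _ _ e _ xpredT).
rewrite [X in (_ <= _ + (X + _))%N](eq_bigl (fun k => (e <= k < m.+1 + e)%N && true)); first lia.
move=> k; rewrite andbT; case: (boolP (e <= k < m.+1 + e)%N) => //= ekm.
have /H/andP[_] : (k - e < m.+1)%N by lia.
by rewrite subnK//; lia.
Qed.

Lemma sum_occurrences_ge D T w d N m :
  m = (N - size w - 2 * T - d)%N ->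
  (forall u v, D u -> D v ->
    exists x y, [/\ (size x <= T)%N, (size y <= T)%N & L (u ++ x ++ w ++ y ++ v)]) ->
  (\sum_(a < m) nb_words D (d + a) * nb_words D (m - a) <=
   T.+1 * T.+1 * \sum_(k < N | (k + d + size w <= N)%N)
     nb_words (occurrences L w (k + d)) N)%N.
Proof.
move=> mE glue.
apply: (@leq_trans (\sum_(a < m) T.+1 * \sum_(e < T.+1)
    nb_words (occurrences L w (a + e + d)) N)%N).
  apply: leq_sum => a _; apply: leq_trans (nb_words_glue_occurrences _ _ glue) _.
  rewrite leq_mul2l/=; apply: leq_sum => e _.
  have am := ltn_ord a.
  have -> : (d + a + (m - a) + size w + 2 * T = N)%N by lia.
  by have -> : (d + a + e = a + e + d)%N by lia.
rewrite -big_distrr/= -mulnA leq_mul2l/= exchange_big/=.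
rewrite -[X in (_ <= X * _)%N]card_ord -sum_nat_const; apply: leq_sum => e _.
pose f k := nb_words (occurrences L w (k + d)) N.
apply: (@sum_shift_le f (fun k => (k + d + size w <= N)%N) e m N) => k km.
by have eT := ltn_ord e; apply/andP; split; lia.
Qed.

End Occurrences.

(* The central word of length N of x starts this many letters to the left of
   its central word of length n. *)
Definition central_offset (s : sidedness) (N n : nat) : nat :=
  match s with OneSided => 0 | TwoSided => N./2 - n./2 end.

Section Points.
Variables (s : sidedness) (p : nat).
Local Notation T := (fullshift s p).
Implicit Types (X : set T) (w : word p) (E : {fset T}).

Lemma iter_left_shift (x : T) k (i : position s) :
  iter k (@left_shift s p) x i = x (advance i k).
Proof.
elim: k i => [|k IH] i; first by case: s i x => i x /=; rewrite ?addn0 ?addr0.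
by rewrite iterS /left_shift IH advanceD add1n.
Qed.

Lemma iter_left_shift_in X k x : shift_space X -> X x -> X (iter k (@left_shift s p) x).
Proof.
move=> [_ _ inv] Xx; elim: k => // k IH; rewrite iterS.
move: inv IH; rewrite /shift_invariant; case: s X x Xx => X x Xx inv IH.
  by apply: inv; exists (iter k (@left_shift OneSided p) x).
by rewrite -inv; exists (iter k (@left_shift TwoSided p) x).
Qed.

Lemma subword_iter_left_shift (x : T) k N n : (k + central_offset s N n + n <= N)%N ->
  subword (iter k (@left_shift s p) x) (cylinder_start s n) n =
  take n (drop (k + central_offset s N n) (subword x (cylinder_start s N) N)).
Proof.
move=> kN; rewrite take_drop_subword//; apply: eq_mkseq => j.
rewrite iter_left_shift !advanceD; congr (x _).
case: s kN x => /= kN x; first by lia.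
have : (n./2 <= N./2)%N by lia.
lia.
Qed.

Lemma nb_occurrences_le X E N k w :
  shift_space X -> one_point_per_cylinder X N E ->
  (k + central_offset s N (size w) + size w <= N)%N ->
  (nb_words (occurrences (language X) w (k + central_offset s N (size w))) N <=
   \sum_(x <- E) (iter k (@left_shift s p) x \in central_cylinder X w))%N.
Proof.
move=> HX [EX EN] kN.
pose F := [pred x : E | iter k (@left_shift s p) (val x) \in central_cylinder X w].
have /nb_words_cover/leq_trans : forall z,
    occurrences (language X) w (k + central_offset s N (size w)) z -> size z = N ->
    exists (i : 'I_1) (x : E), x \in F /\ subword (val x) (cylinder_start s N) N = z.
  move=> z [Lz zw] sz; have [x [[Ex [Xx xz]] _]] := EN z Lz sz.
  exists ord0, [` Ex]%fset; rewrite sz in xz; split=> //=.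
  rewrite !inE/=; split; first exact: iter_left_shift_in.
  by rewrite (subword_iter_left_shift x kN) xz.
apply; rewrite big_ord1 (big_seq_fsetE addn)/= -sum1_card big_mkcond/=.
by apply: leq_sum => x _; rewrite unfold_in /F/=; case: ifP.
Qed.

Lemma card_one_point_le X E N :
  one_point_per_cylinder X N E -> (#|` E| <= nb_words (language X) N)%N.
Proof.
move=> [EX EN].
pose f (x : E) : N.-tuple 'I_p.+1 :=
  tuple_of_word N (subword (val x) (cylinder_start s N) N).
have fE x : f x = subword (val x) (cylinder_start s N) N :> word p.
  by rewrite tuple_of_wordK// size_subword.
rewrite cardfE -(@card_in_imset _ _ f predT); last first.
  move=> x y _ _ /(congr1 (@tval _ _)); rewrite !fE => xy.
  have [z [_ zu]] := EN _ (language_subword (cylinder_start s N) N (EX _ (valP x)))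
    (size_subword _ _ _).
  have cyl u : u \in E -> subword u (cylinder_start s N) N =
      subword (val x) (cylinder_start s N) N -> z = u.
    by move=> Eu ux; apply: zu; split=> //; split; [exact: EX|rewrite size_subword].
  apply: val_inj; transitivity z; first by apply/esym/cyl => //; exact: valP.
  by apply: cyl; [exact: valP|rewrite xy].
apply: subset_leq_card; apply/fintype.subsetP => _ /imsetP[x _ ->].
by rewrite !inE fE; apply: language_subword; exact/EX/valP.
Qed.

Lemma card_one_point_gt0 X E N :
  X !=set0 -> one_point_per_cylinder X N E -> (0 < #|` E|)%N.
Proof.
move=> [x Xx] [_ EN].
have [z [[Ez _] _]] := EN _ (language_subword (cylinder_start s N) N Xx) (size_subword _ _ _).
by rewrite cardfs_gt0; apply/fset0Pn; exists z.
Qed.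

Lemma open_subword (P : word p -> Prop) (i : position s) n :
  open [set x : T | P (subword x i n)].
Proof.
elim: n P => [|n IH] P.
  have [P0|P0] := pselect (P [::]).
    by rewrite (_ : [set _ | _] = setT); [exact: openT|rewrite -subTset].
  by rewrite (_ : [set _ | _] = set0); [exact: open0|rewrite -subset0].
rewrite (_ : [set _ | _] = \bigcup_a ([set x : T | x (advance i n) = a] `&`
    [set x | P (rcons (subword x i n) a)])).
  apply: bigcup_open => a _; apply: openI; last exact: (IH (fun u => P (rcons u a))).
  have := @open_comp _ _ (fun x : T => x (advance i n) : discrete_topology 'I_p.+1) [set a].
  apply; last exact: discrete_open.
  by move=> x _; exact: continuous_projection.
have sE (x : T) : subword x i n.+1 = rcons (subword x i n) (x (advance i n)).
  by rewrite /subword mkseqS.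
apply/seteqP; split => x /=; first by rewrite sE => Px; exists (x (advance i n)).
by move=> [a _ [/= <-]]; rewrite sE.
Qed.

End Points.

Section Measure.
Variables (R : realType) (s : sidedness) (p : nat).
Local Notation T := (borel s p).
Implicit Types (X : set (fullshift s p)) (w : word p) (E : {fset fullshift s p}).

Lemma orbit_average_empiricalE E N (A : set T) :
  orbit_average (empirical R E) N A =
  ((\sum_(k < N) \sum_(x <- E) (iter k (@left_shift s p) x \in A))%N%:R
     / (N%:R * #|` E|%:R))%:E.
Proof.
rewrite /orbit_average (eq_bigr (fun k : 'I_N => (#|` E|%:R^-1 *
    (\sum_(x <- E) (iter k (@left_shift s p) x \in A))%N%:R)%:E)); last first.
  by move=> k _; rewrite /pushforward /empirical EFinM natr_sum -sumEFin.
rewrite sumEFin -EFinM -mulr_sumr -natr_sum invfM; congr EFin; ring.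
Qed.

Lemma limit_measure_cylinder_ge X (E : nat -> {fset fullshift s p})
    (mu : probability (borel s p) R) w (b : R) N0 :
  shift_space X -> limit_measure X E mu ->
  (forall N, (N0 <= N)%N ->
     (b%:E <= orbit_average (empirical R (E N)) N (central_cylinder X w))%E) ->
  (b%:E <= mu (central_cylinder X w))%E.
Proof.
move=> [_ cX _] [_ [phi [phi_incr wcvg]]] lb.
pose A : set (fullshift s p) := [set x | subword x (cylinder_start s (size w)) (size w) = w].
have oA : open A by exact: (@open_subword s p (fun u => u = w)).
have oAC : open (~` A) by exact: (@open_subword s p (fun u => u <> w)).
have mX : measurable (X : set T).
  rewrite -[X]setCK; apply: measurableC; apply: sub_sigma_algebra.
  exact: closed_openC.
have mA : measurable (A : set T) by exact: sub_sigma_algebra.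
have cA : continuous (\1_A : fullshift s p -> R).
  move=> x; have near_x : \forall y \near nbhs x, (\1_A y : R) = \1_A x.
    have [Ax|nAx] := pselect (A x).
      apply: filterS (open_nbhs_nbhs (conj oA Ax)) => y Ay.
      by rewrite !indicE !mem_set.
    apply: filterS (open_nbhs_nbhs (conj oAC nAx)) => y nAy.
    by rewrite !indicE !memNset.
  exact: (@cvg_near_cst _ R (\1_A x : R) (\1_A : fullshift s p -> R) (nbhs x) _ near_x).
have AX : A `&` X = central_cylinder X w by apply/seteqP; split => x [].
have := wcvg _ (continuous_subspaceT cA).
rewrite integral_indic// AX.
under eq_fun do rewrite integral_indic// AX.
apply: cvge_ge; exists N0 => // k /= Nk; apply: lb.
apply: leq_trans Nk _; elim: k => // k IH.
exact: leq_ltn_trans IH (phi_incr _ _ _).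
Qed.

End Measure.

Lemma orbit_average_cylinder_ge (R : realType) (s : sidedness) (p : nat)
    (X : set (fullshift s p)) (D : set (word p)) (E : {fset fullshift s p})
    (w : word p) (h C : R) (T N : nat) :
  shift_space X -> one_point_per_cylinder X N E ->
  (0 < N)%N -> (4 * (size w + 2 * T) <= N)%N -> 0 < C ->
  (forall n, (nb_words (language X) n)%:R <= C * expR (n%:R * h)) ->
  (forall n, expR (n%:R * h) / 2 <= (nb_words D n)%:R) ->
  (forall u v, D u -> D v -> exists x y,
     [/\ (size x <= T)%N, (size y <= T)%N & language X (u ++ x ++ w ++ y ++ v)]) ->
  ((expR (- ((2 * T)%:R * h)) / (16 * C * T.+1%:R ^+ 2) *
     expR (- ((size w)%:R * h)))%:E <=
   orbit_average (empirical R E) N (central_cylinder X w))%E.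
Proof.
move=> HX HE N0 NT C0 Lle Dge glue.
rewrite orbit_average_empiricalE lee_fin.
have X0 : X !=set0 by case: HX.
have EN0 : 0 < #|` E|%:R :> R by rewrite ltr0n (card_one_point_gt0 X0 HE).
have NR0 : 0 < N%:R :> R by rewrite ltr0n.
rewrite ler_pdivlMr ?mulr_gt0//.
pose d := central_offset s N (size w).
have dN : (d <= N./2)%N by rewrite /d /central_offset; case: (s); lia.
pose m := (N - size w - 2 * T - d)%N.
set Q := (\sum_(k < N) _)%N.
have QT : (\sum_(a < m) nb_words D (d + a) * nb_words D (m - a) <= T.+1 * T.+1 * Q)%N.
  apply: leq_trans (sum_occurrences_ge (N := N) (d := d) (w := w) (T := T) erefl glue) _.
  rewrite leq_mul2l/= big_mkcond/=; apply: leq_sum => k _.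
  by case: ifP => // kN; exact: nb_occurrences_le.
pose e := expR ((d + m)%:R * h).
have e0 : 0 < e by exact: expR_gt0.
have mQ : m%:R * (e / 4) <= T.+1%:R ^+ 2 * Q%:R.
  rewrite expr2 -!natrM; move: QT; rewrite -(ler_nat R) => /(le_trans _); apply.
  rewrite mulr_natl -[X in _ *+ X](card_ord m) -sumr_const natr_sum.
  apply: ler_sum => a _; rewrite natrM.
  have -> : e / 4 = expR ((d + a)%:R * h) / 2 * (expR ((m - a)%:R * h) / 2).
    have -> : e = expR ((d + a)%:R * h) * expR ((m - a)%:R * h).
      rewrite -expRD -mulrDl -natrD /e; congr (expR (_%:R * _)).
      by have := ltn_ord a; lia.
    lra.
  by rewrite ler_pM// divr_ge0// expR_ge0.
have Nm : N%:R <= 4 * m%:R :> R by rewrite -natrM ler_nat /m; lia.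
have EC : #|` E|%:R <= C * expR (N%:R * h).
  by apply: le_trans (Lle N); rewrite ler_nat; exact: card_one_point_le.
have eE : expR (- ((2 * T)%:R * h)) * expR (- ((size w)%:R * h)) * expR (N%:R * h) = e.
  rewrite -!expRD /e; congr expR; rewrite -!mulNr -!mulrDl; congr (_ * _).
  have -> : N = (d + m + 2 * T + size w)%N by rewrite /m; lia.
  by rewrite !natrD; ring.
have T0 : 0 < T.+1%:R ^+ 2 :> R by rewrite exprn_gt0.
rewrite -(ler_pM2l T0); apply: le_trans mQ.
set x := expR (- _) in eE *; set y := expR (- _) in eE *.
set t2 := T.+1%:R ^+ 2 in T0 *.
have xy0 : 0 < x * y by rewrite mulr_gt0 ?expR_gt0.
have -> : t2 * (x / (16 * C * t2) * y * (N%:R * #|` E|%:R)) =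
    N%:R * (x * y * #|` E|%:R / C) / 16 by field; rewrite !gt_eqF.
have xyE : x * y * #|` E|%:R / C <= e.
  by rewrite ler_pdivrMr// -eE -[leRHS]mulrA ler_pM2l// mulrC.
have : N%:R * (x * y * #|` E|%:R / C) <= 4 * m%:R * e.
  by rewrite ler_pM// ?divr_ge0 ?mulr_ge0 ?expR_ge0// ltW.
lra.
Qed.

Theorem lemma5p11 (R : realType) (s : sidedness) (p : nat)
    (X : set (fullshift s p)) (Cp G Cs : set (word p))
    (E : nat -> {fset fullshift s p}) (mu : probability (borel s p) R)
    (HX : shift_space X)
    (Hdec : decomposition (language X) Cp G Cs)
    (HI : specification (language X) G)
    (HII : (word_entropy R (Cp `|` Cs) < word_entropy R (language X))%E)
    (Htop : word_entropy R (language X) = topological_entropy R (@left_shift s p) X)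
    (HIII : extendable (language X) Cp G Cs)
    (HE : forall n : nat, (0 < n)%N -> one_point_per_cylinder X n (E n))
    (Hmu : limit_measure X E mu) :
  forall M : nat, exists K : R, 0 < K /\
    forall (n : nat) (w : word p),
      enlarge (language X) Cp G Cs M w -> size w = n ->
      (K%:E * expeR (- (n%:R%:E * word_entropy R (language X)))
         <= mu (central_cylinder X w))%E.
Proof.
move=> M.
have [h hE] : exists h : R, word_entropy R (language X) = h%:E.
  move: HII (word_entropy_ltey R (language X)).
  case: (word_entropy R (language X)) => [h _ _|_|]; [by exists h|by rewrite ltxx|].
  by rewrite ltNge leNye.
have X0 : X !=set0 by case: HX.
rewrite hE in HII *.
have [[C C0 Lle] [M0 Dge]] := nb_words_bounds X0 Hdec HI HII hE.
have [T glue] := enlarge_glue M M0 HI HIII.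
exists (expR (- ((2 * T)%:R * h)) / (16 * C * T.+1%:R ^+ 2)); split.
  by rewrite divr_gt0 ?expR_gt0 ?mulr_gt0 ?exprn_gt0.
move=> _ w Gw <-; rewrite -EFinM.
apply: (@limit_measure_cylinder_ge _ _ _ _ E mu w _ (4 * (size w + 2 * T)).+1 HX Hmu).
move=> N NT; have N0 : (0 < N)%N by lia.
apply: (orbit_average_cylinder_ge HX (HE N N0) N0 _ C0 Lle Dge); first by lia.
by move=> u v Du Dv; exact: glue.
Qed.
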